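(* Let $T$ be a bounded linear operator on a complex Banach space $X$. The following are equivalent: (i) $T$ is uniformly ergodic with $\sigma(T)\cap \mathbb T = \emptyset$. (ii) $r(T) \le 1$ and $\sigma(T)\cap \mathbb T = \emptyset$. (iii) $\|T^n\| \to 0$. (iv) $\|T^n\|/n \to 0$, and for every $x \in X$ the series $\sum_{n=1}^\infty \frac{\lambda^n T^n x}{n}$ converges in norm for every $\lambda \in \mathbb T$. (v) $T$ is rotationally uniformly ergodic with $\sigma(T)\cap \mathbb T = \emptyset$.
   Context: $\mathbb T$ is the unit circle in $\mathbb C$; $\sigma(T)$ and $r(T)$ are the spectrum and the spectral radius of $T$. A bounded operator $S$ is uniformly ergodic if $\frac1n\sum_{k=1}^nS^k$ converges in operator norm. $T$ is rotationally uniformly ergodic if $\lambda T$ is uniformly ergodic for every $\lambda\in\mathbb T$. *)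

(* Defs.v *)
From HB Require Import structures.
From mathcomp Require Import all_boot all_order all_algebra.
From mathcomp Require Import all_classical all_reals all_analysis.
From mathcomp Require Import complex.
Set Implicit Arguments.
Unset Strict Implicit.
Unset Printing Implicit Defensive.
Import Order.TTheory GRing.Theory Num.Theory.
Import numFieldNormedType.Exports.
Local Open Scope classical_set_scope.
Local Open Scope ring_scope.
Local Open Scope complex_scope.

(* A complex Banach space is a [completeNormedModType R[i]] with [R : realType].
   Its norm takes values in [R[i]] (nonnegative reals); [rnorm] is the same
   quantity read in [R]. *)
Definition rnorm (R : realType) (V : normedModType R[i]) (x : V) : R :=
  complex.Re `|x|.

(* Operators are functions [X -> X]. The supremum is the operator norm when [S]
   is linear and continuous, which holds wherever [opnorm] is used. *)
Definition opnorm (R : realType) (X : normedModType R[i]) (S : X -> X) : R :=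
  sup [set rnorm (S x) | x in [set x : X | `|x| <= 1]].

Definition unit_circle (R : realType) : set R[i] := [set z | `|z| = 1].

(* [z] is in the spectrum iff [z I - T] has no two-sided inverse in the algebra
   of bounded operators. *)
Definition spectrum (R : realType) (X : normedModType R[i]) (T : X -> X) :
    set R[i] :=
  [set z | ~ exists S : {linear X -> X}, [/\ continuous S,
     forall x, S (z *: x - T x) = x & forall x, z *: S x - T (S x) = x]].

(* For bounded [T] on a nonzero Banach space the supremum is over a nonempty
   bounded set. If [X = 0], the spectrum is empty and the value is [0], since
   [sup set0 = 0]. *)
Definition spectral_radius (R : realType) (X : normedModType R[i])
    (T : X -> X) : R :=
  sup [set complex.Re `|z| | z in spectrum T].

(* The value at [n = 0] is the zero operator. *)
Definition cesaro (R : realType) (X : normedModType R[i]) (S : X -> X)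
    (n : nat) (x : X) : X :=
  n%:R^-1 *: \sum_(1 <= k < n.+1) iter k S x.

Definition uniformly_ergodic (R : realType) (X : normedModType R[i])
    (S : X -> X) : Prop :=
  exists P : {linear X -> X}, continuous P /\
    opnorm (fun x => cesaro S n x - P x) @[n --> \oo] --> (0 : R).

Definition rotationally_uniformly_ergodic (R : realType)
    (X : normedModType R[i]) (T : X -> X) : Prop :=
  forall z : R[i], unit_circle z -> uniformly_ergodic (fun x => z *: T x).

(* Main.v *)
Require Import Defs.
From HB Require Import structures.
From mathcomp Require Import all_boot all_order all_algebra.
From mathcomp Require Import all_classical all_reals all_analysis.
From mathcomp Require Import complex.
From mathcomp Require Import lra ring.
Set Implicit Arguments.
Unset Strict Implicit.
Unset Printing Implicit Defensive.
Import Order.TTheory GRing.Theory Num.Theory.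
Import numFieldNormedType.Exports.
Local Open Scope classical_set_scope.
Local Open Scope ring_scope.
Local Open Scope complex_scope.
Import ComplexField.Normc.

(** The whole proof is about solving [x - S x = y] for [S = l T] with [l] a
    complex number; for [l] nonzero, [1 - l T] is invertible exactly when [l^-1] is
    off the spectrum of [T].  Invertibility of [1 - S] is handled as the
    conjunction of a lower bound [rnorm x <= c * rnorm (x - S x)] and of
    solvability; these two halves have different reasons, so they are kept apart.

    (i) => (ii).  The identity [T^n = n A_n - (n-1) A_(n-1)] between powers and
    Cesaro means gives linear growth of [T^n], so [(l T)^n] becomes a strict
    contraction when [|l| < 1], and the Neumann series inverts [1 - l T].

    (ii) => (iii).  The hypothesis bounds [1 - l T] below for each [l] in the
    closed unit disk, hence by one constant [M] on the whole disk by compactness.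
    Then [l |-> (1 - l T)^-1] is Lipschitz with a constant depending only on [M]
    and the norm of [T].  The averaging formula
      [(1 - v^2 S^2)^-1 = ((1 - v S)^-1 + (1 + v S)^-1) / 2]
    transports closeness of the resolvents of [rT] and [sT] on the unit circle to
    those of [(rT)^N] and [(sT)^N], [N = 2^m], with no loss
    ([resolvents_close_sqr]).  If [(rT)^n] tends to 0, the first resolvent tends
    to 1, so the second is eventually near 1, which forces [(sT)^N] to be small
    ([resolvents_close_stable]).  Finitely many such steps go from [r = 0] to
    [r = 1].  This replaces contour integrals and the spectral radius formula.

    (iii) => (iv).  A power of [T] has norm at most 1/2, so the norms of the
    [T^n x] are summable.

    (iv) => (v).  Let [S = z T] with [|z| = 1].  By uniform boundedness the
    partial sums of [sum S^n / n] are bounded by some [C].  On a vector almost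
    fixed by [S] the N-th partial sum is almost multiplication by the N-th
    harmonic number, which exceeds [C]; so there is no such vector, that is
    [1 - S] is bounded below ([log_series_bounded_below]).  As [1 - r S] is
    invertible for [r < 1], the lower bound passes solvability to the limit
    [r = 1] ([boundary_solvable]).  Finally [x = y - S y] makes the Cesaro sums
    telescope to [S y - S^(n+1) y], which is [o(n)], so the means tend to 0
    ([regular_uniformly_ergodic]).

    (v) => (i) is the case [z = 1]. *)

(** * The norm with real values *)

Section RealNorm.
Variables (R : realType) (V : normedModType R[i]).
Implicit Types (x y : V) (a : R[i]).

Lemma normE x : `|x| = (rnorm x)%:C.
Proof. by rewrite /rnorm RRe_real ?normr_real. Qed.

Lemma normcE a : `|a| = (normc a)%:C.
Proof. by []. Qed.

Lemma normc_ge0 a : 0 <= normc a.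
Proof. by rewrite -lecR -normcE; exact: normr_ge0. Qed.

Lemma rnorm_ge0 x : 0 <= rnorm x.
Proof. by rewrite -lecR -normE; exact: normr_ge0. Qed.

Lemma rnorm0 : rnorm (0 : V) = 0.
Proof. by rewrite /rnorm normr0. Qed.

Lemma rnorm0_eq0 x : rnorm x <= 0 -> x = 0.
Proof.
move=> x0; apply/normr0_eq0; rewrite normE.
by rewrite (@le_anti _ _ (rnorm x) 0)// x0 rnorm_ge0.
Qed.

Lemma rnormN x : rnorm (- x) = rnorm x.
Proof. by rewrite /rnorm normrN. Qed.

Lemma rnormBC x y : rnorm (x - y) = rnorm (y - x).
Proof. by rewrite -rnormN opprB. Qed.

Lemma rnormD x y : rnorm (x + y) <= rnorm x + rnorm y.
Proof. by rewrite -lecR rmorphD/= -!normE ler_normD. Qed.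

Lemma rnormB x y : rnorm (x - y) <= rnorm x + rnorm y.
Proof. by rewrite -(rnormN y) rnormD. Qed.

Lemma rnorm_dist z x y : rnorm (x - y) <= rnorm (x - z) + rnorm (z - y).
Proof. by rewrite -[in leLHS](subrK z x) -addrA rnormD. Qed.

Lemma rnormZ a x : rnorm (a *: x) = normc a * rnorm x.
Proof. by apply: complexI; rewrite rmorphM/= -!normE normrZ. Qed.

Lemma rnorm_sum (I : Type) (s : seq I) (P : pred I) (F : I -> V) :
  rnorm (\sum_(i <- s | P i) F i) <= \sum_(i <- s | P i) rnorm (F i).
Proof.
elim/big_ind2: _ => [|x1 r1 x2 r2 h1 h2|//]; first by rewrite rnorm0.
by rewrite (le_trans (rnormD _ _)) ?lerD.
Qed.

Lemma normc_real (r : R) : normc r%:C = `|r|.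
Proof. by rewrite /normc/= expr0n/= addr0 sqrtr_sqr. Qed.

Lemma normc_nat n : normc (n%:R : R[i]) = n%:R.
Proof.
by rewrite -[n%:R in LHS](rmorph_nat (real_complex R)) normc_real normr_nat.
Qed.

Lemma normcX a n : normc (a ^+ n) = normc a ^+ n.
Proof. by elim: n => [|n IH]; rewrite ?expr0 ?normc1// !exprS normcM IH. Qed.

Lemma cvg_rnormP (u : nat -> V) x : u @ \oo --> x <->
  forall e : R, 0 < e -> exists N, forall n, (N <= n)%N -> rnorm (x - u n) <= e.
Proof.
split.
  move/cvgrPdist_le => h e e0.
  have : (0 : R[i]) < e%:C by rewrite ltcR.
  move=> /h [N _ hN]; exists N => n Nn.
  by rewrite -lecR -normE; exact: hN.
move=> h; apply/cvgrPdist_le => e e0.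
have eE : e = (complex.Re e)%:C by rewrite RRe_real// gtr0_real.
have : 0 < complex.Re e by rewrite -ltcR -eE.
move=> /h [N hN]; exists N => // n Nn.
by rewrite eE normE lecR; exact: hN.
Qed.

End RealNorm.

(** * Completeness *)

Section Completeness.
Variables (R : realType) (X : completeNormedModType R[i]).

Lemma series_cvg_of_bounded_rnorm (u : nat -> X) (B : R) :
  (forall n, \sum_(0 <= k < n) rnorm (u k) <= B) -> cvgn (series u).
Proof.
move=> uB; apply/cauchy_cvgP/cauchy_seriesP => e e0.
have eE : e = (complex.Re e)%:C by rewrite RRe_real// gtr0_real.
have re0 : 0 < complex.Re e by rewrite -ltcR -eE.
have /cauchy_cvgP/cauchy_seriesP/(_ _ re0) : cvgn (series (fun k => rnorm (u k))).
  apply: nondecreasing_is_cvgn.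
    by apply: nondecreasing_series => n _ _; exact: rnorm_ge0.
  by exists B => _ [n _ <-]; exact: uB.
apply: filterS => -[m n] /= h; rewrite eE normE ltcR.
apply: le_lt_trans (rnorm_sum _ _ _) _; apply: le_lt_trans h.
exact: ler_norm.
Qed.

Lemma geometric_sum_le (C q : R) m n : 0 <= C -> 0 <= q -> q < 1 ->
  \sum_(m <= k < n) C * q ^+ k <= C * q ^+ m / (1 - q).
Proof.
move=> C0 q0 q1.
have [nm|mn] := leqP n m.
  by rewrite big_geq// !mulr_ge0 ?exprn_ge0// invr_ge0 subr_ge0 ltW.
rewrite ler_pdivlMr ?subr_gt0// -mulr_sumr -mulrA ler_wpM2l//.
rewrite -(subnK (ltnW mn)) mulr_suml.
rewrite (_ : \sum_(_ <= k < _) _ = q ^+ m - q ^+ (n - m + m)).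
  by rewrite gerBl exprn_ge0.
rewrite subnK ?(ltnW mn)//.
under eq_bigr do rewrite mulrBr mulr1 -exprSr -opprB.
by rewrite sumrN telescope_sumr ?opprB// ltnW.
Qed.

Lemma geometric_small (C q e : R) : 0 <= q -> q < 1 -> 0 < e ->
  exists N, forall n, (N <= n)%N -> C * q ^+ n <= e.
Proof.
move=> q0 q1 e0.
have cq : (fun n => C * q ^+ n) @ \oo --> (0 : R).
  rewrite -[X in _ --> X](mulr0 C).
  by apply: cvgMl_tmp; apply: cvg_expr; rewrite ger0_norm.
have [N _ hN] := (cvgrPdist_le _ _).1 cq _ e0.
exists N => n Nn; rewrite (le_trans (ler_norm _))//.
by have := hN n Nn; rewrite /= sub0r normrN.
Qed.

(** Completeness in quantitative form: the rate is what the gliding hump of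
    [uniform_boundedness] needs. *)
Lemma geometric_limit (x : nat -> X) (C q : R) : 0 <= C -> 0 <= q -> q < 1 ->
  (forall n, rnorm (x n.+1 - x n) <= C * q ^+ n) ->
  exists l, forall n, rnorm (l - x n) <= C * q ^+ n / (1 - q).
Proof.
move=> C0 q0 q1 xq.
have cvx : cvgn (series (fun k => x k.+1 - x k)).
  apply: (@series_cvg_of_bounded_rnorm _ (C / (1 - q))) => n.
  rewrite (le_trans (ler_sum _ (fun k _ => xq k)))//.
  by rewrite (le_trans (geometric_sum_le _ _ C0 q0 q1))// expr0 mulr1.
set s := limn (series _) in cvx.
exists (s + x 0) => n; apply/ler_addgt0Pr => e e0.
have [N hN] := (cvg_rnormP _ _).1 cvx e e0.
have {hN} := hN (maxn N n) (leq_maxl _ _).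
rewrite /series/= telescope_sumr// opprB addrA => hN.
rewrite (le_trans (rnorm_dist (x (maxn N n)) _ _))// addrC lerD//.
rewrite -telescope_sumr ?leq_maxr//.
rewrite (le_trans (rnorm_sum _ _ _))//.
by rewrite (le_trans (ler_sum _ (fun k _ => xq k)))// geometric_sum_le.
Qed.

Lemma contraction_fixpoint (f : X -> X) (q : R) : 0 <= q -> q < 1 ->
  (forall x y, rnorm (f x - f y) <= q * rnorm (x - y)) -> exists x, f x = x.
Proof.
move=> q0 q1 fq; pose x n := iter n f 0.
have xq n : rnorm (x n.+1 - x n) <= rnorm (f 0) * q ^+ n.
  elim: n => [|n IH]; first by rewrite /x/= subr0 expr0 mulr1.
  rewrite (le_trans (fq _ _))// exprS [leRHS]mulrCA ler_wpM2l//.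
have [l hl] := geometric_limit (rnorm_ge0 _) q0 q1 xq; exists l.
set C := rnorm (f 0) in hl.
have C0 : 0 <= C by exact: rnorm_ge0.
apply/eqP; rewrite -subr_eq0; apply/eqP; apply: rnorm0_eq0.
have D n : rnorm (f l - l) <= q ^+ n * (2 * (C / (1 - q))).
  rewrite (le_trans (rnorm_dist (x n.+1) _ _))// (rnormBC _ l).
  have h1 := le_trans (fq l (x n)) (ler_wpM2l q0 (hl n)).
  have h2 := hl n.+1.
  set P := q ^+ n * (C / (1 - q)).
  have P0 : 0 <= P by rewrite mulr_ge0 ?exprn_ge0// divr_ge0// subr_ge0 ltW.
  rewrite (le_trans (lerD h1 h2))// exprS.
  rewrite [leLHS](_ : _ = (2 * q) * P); last by rewrite /P; ring.
  by rewrite [leRHS]mulrCA -/P -!mulrA ler_wpM2l// ler_piMl// ltW.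
apply/ler_addgt0Pr => e e0; rewrite add0r.
have [N /(_ N (leqnn N))] := geometric_small (2 * (C / (1 - q))) q0 q1 e0.
by rewrite mulrC; exact: le_trans.
Qed.

End Completeness.

(** * Bounded operators and the operator norm *)

Section Operators.
Variables (R : realType) (X : normedModType R[i]).
Implicit Types (S T : {linear X -> X}) (f : X -> X) (b c : R) (a : R[i]).

Definition bounded_by b f := forall x, rnorm (f x) <= b * rnorm x.

Lemma iter_is_linear n S : linear (iter n S).
Proof. by move=> a x y; elim: n => //= n ->; rewrite linearP. Qed.

HB.instance Definition _ n S :=
  GRing.isLinear.Build R[i] X X *:%R (iter n S) (iter_is_linear n S).

Lemma bounded_by_le b c f : b <= c -> bounded_by b f -> bounded_by c f.
Proof. by move=> bc h x; rewrite (le_trans (h x))// ler_wpM2r// rnorm_ge0. Qed.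

Lemma bounded_by_comp b c f (g : X -> X) :
  0 <= b -> bounded_by b f -> bounded_by c g -> bounded_by (b * c) (f \o g).
Proof. by move=> b0 hf hg x; rewrite (le_trans (hf _))// -mulrA ler_wpM2l. Qed.

Lemma bounded_by_iter b f n :
  0 <= b -> bounded_by b f -> bounded_by (b ^+ n) (iter n f).
Proof.
move=> b0 h; elim: n => [|n IH] x; first by rewrite expr0 mul1r.
by rewrite exprS; exact: (bounded_by_comp b0 h IH).
Qed.

Lemma bounded_by_scale b f a :
  bounded_by b f -> bounded_by (normc a * b) (fun x => a *: f x).
Proof. by move=> h x; rewrite rnormZ -mulrA ler_wpM2l// normc_ge0. Qed.

Lemma iter_scale n a S x : iter n (a \*: S) x = a ^+ n *: iter n S x.
Proof. by elim: n => [|n IH]; rewrite ?scale1r//= IH linearZ/= scalerA exprS. Qed.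

Lemma continuous_bounded S : continuous S -> exists2 b : R, 0 <= b & bounded_by b S.
Proof.
move=> cS; have /linear_boundedP[M [Mreal hM]] : bounded_near S (nbhs (0 : X)).
  exact: continuous_linear_bounded (cS 0).
pose b := `|complex.Re M| + 1; have b0 : 0 <= b by rewrite addr_ge0.
have Mb : M < b%:C.
  by rewrite -(RRe_real Mreal) ltcR (le_lt_trans (ler_norm _))// ltrDl.
by exists b => // x; have := hM _ Mb x; rewrite !normE -rmorphM lecR.
Qed.

Lemma bounded_continuous S b : bounded_by b S -> continuous S.
Proof.
move=> hb; apply: bounded_linear_continuous; apply/linear_boundedP.
exists (b%:C); split; first by apply/complex_realP; exists b.
move=> y; rewrite ltcE/= => /andP[/eqP y0 by_] x.
rewrite normE (_ : y = (complex.Re y)%:C); last by case: y y0 {by_} => ? ? /= ->.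
rewrite normE -rmorphM/= lecR (le_trans (hb x))// ler_wpM2r ?rnorm_ge0// ltW//.
Qed.

End Operators.

Section OperatorNorm.
Variables (R : realType) (X : normedModType R[i]).
Implicit Types (f : X -> X) (b : R).

Lemma ball_rnorm (x : X) : (`|x| <= 1) = (rnorm x <= 1).
Proof. by rewrite normE -(rmorph1 (real_complex R)) lecR. Qed.

Lemma opnorm_le b f : 0 <= b -> bounded_by b f -> opnorm f <= b.
Proof.
move=> b0 h; apply: ge_sup.
  by exists (rnorm (f 0)), 0 => //=; rewrite normr0.
move=> _ [x /= + <-]; rewrite ball_rnorm => x1.
by rewrite (le_trans (h x))// ler_piMr.
Qed.

Lemma le_opnorm b f x :
  0 <= b -> bounded_by b f -> rnorm x <= 1 -> rnorm (f x) <= opnorm f.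
Proof.
move=> b0 h x1; apply: ub_le_sup; last by exists x => //=; rewrite ball_rnorm.
exists b => _ [y /= + <-]; rewrite ball_rnorm => y1.
by rewrite (le_trans (h y))// ler_piMr.
Qed.

Lemma opnorm_ge0 b f : 0 <= b -> bounded_by b f -> 0 <= opnorm f.
Proof.
move=> b0 h; apply: le_trans (rnorm_ge0 (f 0)) _.
by apply: le_opnorm b0 h _; rewrite rnorm0 ler01.
Qed.

Lemma opnorm_bound b f : 0 <= b -> bounded_by b f ->
  (forall a x, f (a *: x) = a *: f x) -> bounded_by (opnorm f) f.
Proof.
move=> b0 h fZ x; have [x0|x0] := leP (rnorm x) 0.
  by rewrite (rnorm0_eq0 x0) rnorm0 mulr0 -(mulr0 b) -[in leRHS](rnorm0 X) h.
rewrite -ler_pdivrMr// mulrC.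
have n1 : normc (rnorm x)^-1%:C = (rnorm x)^-1.
  by rewrite normc_real ger0_norm// invr_ge0 ltW.
have := @le_opnorm b f ((rnorm x)^-1%:C *: x) b0 h.
by rewrite fZ !rnormZ n1 mulVf ?gt_eqF//; exact.
Qed.

Definition op_null (f : nat -> X -> X) := forall e : R, 0 < e ->
  exists N, forall n, (N <= n)%N -> bounded_by e (f n).

Lemma op_nullP (f : nat -> X -> X) :
  (forall n, exists2 b : R, 0 <= b & bounded_by b (f n)) ->
  (forall n a x, f n (a *: x) = a *: f n x) ->
  (opnorm (f n) @[n --> \oo] --> (0 : R)) <-> op_null f.
Proof.
move=> fb fZ; split.
  move/cvgrPdist_le => h e /h[N _ hN]; exists N => n /hN /=.
  rewrite sub0r normrN => fe; have [b b0 hb] := fb n.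
  by apply: bounded_by_le (opnorm_bound b0 hb (fZ n));
    exact: le_trans (ler_norm _) fe.
move=> h; apply/cvgrPdist_le => e e0; have [N hN] := h e e0.
exists N => // n Nn /=; have [b b0 hb] := fb n.
rewrite sub0r normrN ger0_norm ?(opnorm_ge0 b0 hb)//.
by apply: opnorm_le (ltW e0) _; exact: hN.
Qed.

End OperatorNorm.

(** * Invertibility of 1 - S *)

Section Invertibility.
Variables (R : realType) (X : completeNormedModType R[i]).
Implicit Types (S T : {linear X -> X}) (f : X -> X)
  (b c q r s eps K M : R).

(** Concerns [1 - f] rather than [f]: injectivity with closed range, in
    quantitative form. *)
Definition bounded_below (c : R) f := forall x, rnorm x <= c * rnorm (x - f x).

Definition solvable f := forall y, exists x, x - f x = y.

(** For a linear [f], invertibility of [1 - f] in the bounded operators: the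
    inverse exists by solvability and is bounded by the lower bound. *)
Definition regular f := (exists2 c : R, 0 <= c & bounded_below c f) /\ solvable f.

Lemma contraction_regular S q : 0 <= q -> q < 1 -> bounded_by q S ->
  bounded_below (1 - q)^-1 S /\ solvable S.
Proof.
move=> q0 q1 hq; split=> [x|y].
  rewrite mulrC ler_pdivlMr ?subr_gt0// mulrBr mulr1 lerBlDr.
  rewrite -[in leLHS](subrK (S x) x) (le_trans (rnormD _ _))// lerD2l mulrC.
  exact: hq.
have [|x hx] := @contraction_fixpoint _ _ (fun x => y + S x) q q0 q1.
  by move=> u v; rewrite opprD addrACA subrr add0r -linearB hq.
by exists x; rewrite -{1}hx addrK.
Qed.

Lemma telescope_iter S N x :
  \sum_(0 <= k < N) (iter k S x - iter k S (S x)) = x - iter N S x.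
Proof.
under eq_bigr do rewrite -iterSr -opprB.
by rewrite sumrN telescope_sumr//= opprB.
Qed.

(** [1 - S^N] factors as [1 - S] times [sum_(k < N) S^k], and the factors
    commute; so both halves of invertibility descend from [S^N] to [S]. *)
Lemma power_regular S b q N : 0 <= b -> bounded_by b S ->
  0 <= q -> q < 1 -> bounded_by q (iter N S) -> regular S.
Proof.
move=> b0 hb q0 q1 hq.
have [hbel hsol] := @contraction_regular (iter N S) q q0 q1 hq.
split=> [|y]; last first.
  have [x hx] := hsol y; exists (\sum_(0 <= k < N) iter k S x).
  by rewrite linear_sum -sumrB -hx -telescope_iter; apply: eq_bigr => k _;
    rewrite -iterSr.
have Q0 : 0 <= (1 - q)^-1 by rewrite invr_ge0 subr_ge0 ltW.
exists ((1 - q)^-1 * \sum_(0 <= k < N) b ^+ k).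
  by rewrite mulr_ge0// sumr_ge0// => k _; rewrite exprn_ge0.
move=> x; rewrite (le_trans (hbel x))// -mulrA ler_wpM2l//.
rewrite -telescope_iter (le_trans (rnorm_sum _ _ _))// mulr_suml ler_sum// => k _.
by rewrite -linearB; exact: bounded_by_iter.
Qed.

(** Some [s < 1] has [r <= s^2], and [n s^n] stays bounded by [1 / (1 - s)]
    while the remaining factor [s^n] tends to 0. *)
Lemma mul_expr_small (r K : R) n0 : 0 <= r -> r < 1 ->
  exists2 n, (n0 <= n)%N & K * n%:R * r ^+ n <= 2^-1.
Proof.
move=> r0 r1; pose s := (1 + r) / 2.
have s0 : 0 <= s by rewrite /s; lra.
have s1 : s < 1 by rewrite /s; lra.
have rs : r <= s * s by rewrite /s; nra.
have sn n : n%:R * (1 - s) * s ^+ n <= 1 - s ^+ n.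
  elim: n => [|n IH]; first by rewrite !mul0r expr0 subrr.
  have p0 : 0 <= s ^+ n by exact: exprn_ge0.
  have p1 : s ^+ n <= 1 by rewrite exprn_ile1// ltW.
  rewrite -natr1 exprS; set p := s ^+ n in IH p0 p1 *; set m := n%:R in IH *.
  have h : s * (m * (1 - s) * p) <= s * (1 - p) by rewrite ler_wpM2l.
  have h2 : s * p * (1 - s) <= 1 - s.
    by rewrite ler_piMl ?subr_ge0 ?(ltW s1)// mulr_ile1// ltW.
  nra.
have half0 : 0 < 2^-1 :> R by rewrite invr_gt0.
have [N hN] := geometric_small (`|K| / (1 - s)) s0 s1 half0.
exists (maxn n0 N); first exact: leq_maxl.
set n := maxn _ _; apply: le_trans (hN n (leq_maxr _ _)).
have p0 : 0 <= s ^+ n by exact: exprn_ge0.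
have rn : r ^+ n <= s ^+ n * s ^+ n by rewrite -exprMn lerXn2r// nnegrE mulr_ge0.
rewrite -mulrA (le_trans (ler_norm _))// normrM -mulrA ler_wpM2l//.
rewrite ger0_norm ?mulr_ge0 ?exprn_ge0//.
rewrite (le_trans (ler_wpM2l _ rn))// mulrA ler_wpM2r//.
rewrite -[leRHS]mul1r ler_pdivlMr ?subr_gt0//.
rewrite mulrAC (le_trans (sn n))// gerBl//.
Qed.

Lemma growth_regular T b K n0 (a : R[i]) : 0 <= b -> bounded_by b T -> 0 <= K ->
  (forall n, (n0 <= n)%N -> bounded_by (K * n%:R) (iter n T)) ->
  normc a < 1 -> regular (a \*: T).
Proof.
move=> b0 hb K0 hK a1.
have [n n0n hn] := mul_expr_small K n0 (normc_ge0 a) a1.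
apply: (@power_regular _ (normc a * b) 2^-1 n); rewrite ?invr_ge0 ?ler0n//.
- by rewrite mulr_ge0// normc_ge0.
- exact: bounded_by_scale.
- by rewrite invf_lt1// ltr1n.
move=> x; rewrite iter_scale.
apply: le_trans (bounded_by_scale (a ^+ n) (hK n n0n) x) _.
by rewrite normcX ler_wpM2r ?rnorm_ge0// mulrC.
Qed.

(** A uniform lower bound makes invertibility a closed condition.  For
    [r = 1 - t] near 1 the operator [1 - r S] keeps the lower bound up to a factor
    2, so its inverse [g] is [2c]-Lipschitz, and [x - S x = y] becomes the fixed
    point equation [x = g (y + t S x)] with ratio [2 c t b < 1]. *)
Lemma boundary_solvable S b c :
  0 <= b -> bounded_by b S -> 0 <= c -> bounded_below c S ->
  (forall r : R, 0 <= r -> r < 1 -> solvable (r%:C \*: S)) -> solvable S.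
Proof.
move=> b0 hb c0 hc hr y.
pose t : R := (2 * (1 + c * b))^-1.
have cb0 : 0 <= c * b by exact: mulr_ge0.
have t0 : 0 < t by rewrite invr_gt0; lra.
have tE : t * (1 + c * b) = 2^-1.
  by rewrite /t invfM -mulrA mulVf ?mulr1// gt_eqF//; lra.
have t1 : t <= 1 by nra.
pose r := 1 - t.
have [g hg] := choice (hr r ltac:(rewrite /r; lra) ltac:(rewrite /r; lra)).
have {}hg v : g v - r%:C *: S (g v) = v := hg v.
have SB u v : S u - S v = S (u - v) by rewrite linearB.
have below x : rnorm x <= 2 * c * rnorm (x - r%:C *: S x).
  have e : x - S x = (x - r%:C *: S x) - t%:C *: S x.
    by rewrite /r rmorphB/= rmorph1 scalerBl scale1r opprB addrA addrAC addrK.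
  have := hc x; rewrite e => h.
  have h1 := rnormB (x - r%:C *: S x) (t%:C *: S x).
  rewrite rnormZ normc_real gtr0_norm// in h1.
  have h2 := hb x; set A := rnorm (x - _ - _) in h h1.
  set B := rnorm (x - _) in h1 *.
  have B0 : 0 <= B := rnorm_ge0 _.
  have x0 := rnorm_ge0 x; set w := rnorm (S x) in h1 h2.
  set v := rnorm x in h h2 x0 *.
  have h3 : c * A <= c * (B + t * w) by rewrite ler_wpM2l.
  have h4 : c * t * w <= c * t * (b * v) by rewrite ler_wpM2l// mulr_ge0// ltW.
  have h5 : t * (c * b) <= 2^-1 by nra.
  have h6 : t * (c * b) * v <= 2^-1 * v by rewrite ler_wpM2r.
  nra.
have gL u v : rnorm (g u - g v) <= 2 * c * rnorm (u - v).
  by have := below (g u - g v); rewrite linearB scalerBr opprD addrACA -opprD !hg.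
have [|||x hx] :=
  @contraction_fixpoint _ _ (fun x => g (y + t%:C *: S x)) (2 * c * (t * b)).
- by rewrite !mulr_ge0// ltW.
- by nra.
- move=> u v; rewrite (le_trans (gL _ _))// -[leRHS]mulrA ler_wpM2l ?mulr_ge0//.
  rewrite opprD addrACA subrr add0r -scalerBr SB rnormZ normc_real gtr0_norm//.
  by rewrite -mulrA ler_wpM2l// ltW.
exists x; have := hg (y + t%:C *: S x); rewrite hx /= /r rmorphB/= rmorph1.
rewrite scalerBl scale1r.
by rewrite opprB addrA addrAC => /addIr.
Qed.

(** The solution operator of [x - z^-1 T x = y] is linear by uniqueness and
    bounded by the lower bound; rescaled by [z^-1] it inverts [z - T]. *)
Lemma regular_notin_spectrum T (z : R[i]) : z != 0 -> regular (z^-1 \*: T) ->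
  ~ spectrum T z.
Proof.
move=> z0 [[c c0 hc] hs]; apply; have [g hg] := choice hs.
have {}hg v : g v - z^-1 *: T (g v) = v := hg v.
have inj u v : u - z^-1 *: T u = v - z^-1 *: T v -> u = v.
  move=> h; apply: subr0_eq; apply: rnorm0_eq0; rewrite (le_trans (hc _))//=.
  by rewrite linearB scalerBr opprD addrACA -opprD h subrr rnorm0 mulr0.
have glin : linear g.
  move=> a u v; apply: inj; rewrite hg linearP scalerDr opprD addrACA (hg v).
  by rewrite [z^-1 *: _]scalerA mulrC -scalerA -scalerBr (hg u).
pose G : {linear X -> X} := HB.pack g (GRing.isLinear.Build _ _ _ _ _ glin).
have Gc : continuous G.
  by apply: (@bounded_continuous _ _ _ c) => x; have := hc (g x); rewrite /= hg.
have TS x : z *: (z^-1 *: g x) - T (z^-1 *: g x) = x.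
  by rewrite scalerA mulfV// scale1r linearZ hg.
exists (z^-1 \*: G); split => // x.
- by apply: cvgZl_tmp; exact: Gc.
- apply: inj; rewrite /= [T (z^-1 *: _)]linearZ/= -scalerBr hg.
  by rewrite scalerBr scalerA mulVf// scale1r.
Qed.

Lemma notin_spectrum_bounded_below T (z : R[i]) : z != 0 -> ~ spectrum T z ->
  exists2 c : R, 0 <= c & bounded_below c (z^-1 \*: T).
Proof.
move=> z0 /contrapT[S [cS SK _]]; have [b b0 hb] := continuous_bounded cS.
exists (b * normc z) => [|x]; first by rewrite mulr_ge0// normc_ge0.
rewrite -[in leLHS](SK x) (le_trans (hb _))// -mulrA ler_wpM2l// -rnormZ.
by rewrite scalerBr scalerA mulfV// scale1r.
Qed.

End Invertibility.

(** * Powers tending to zero *)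

Section PowersToZero.
Variables (R : realType) (X : completeNormedModType R[i]).
Implicit Types (S T : {linear X -> X}) (f : X -> X)
  (b c q r s eps K M : R).

(** For a bounded linear [f] this finite condition is equivalent to
    convergence of the powers of [f] to 0 in operator norm
    ([stable_op_null], [op_null_stable]). *)
Definition stable f := exists2 n, (0 < n)%N & bounded_by (2^-1 : R) (iter n f).

Lemma iterM n m f : iter (n * m) f =1 iter n (iter m f).
Proof. by elim: n => // n IH x; rewrite mulSn iterD IH. Qed.

Lemma stable_op_null S b : 0 <= b -> bounded_by b S -> stable S ->
  op_null (fun n => iter n S).
Proof.
move=> b0 hb [m m0 hm] e e0; pose B := b + 1.
have B1 : 1 <= B by rewrite lerDr.
have B0 : 0 <= B by rewrite (le_trans _ B1).
have hB : bounded_by B S by apply: bounded_by_le hb; rewrite lerDl.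
have h0 : 0 <= 2^-1 :> R by rewrite invr_ge0.
have h1 : 2^-1 < 1 :> R by rewrite invf_lt1// ltr1n.
have [N hN] := geometric_small (B ^+ m) h0 h1 e0.
exists (N * m)%N => n Nn.
have Nnm : (N <= n %/ m)%N by rewrite leq_divRL.
apply: (bounded_by_le (hN _ Nnm)) => x.
rewrite {1}(divn_eq n m) addnC iterD iterM -mulrA.
rewrite (le_trans (bounded_by_iter _ B0 hB _))//.
apply: ler_pM; rewrite ?exprn_ge0 ?rnorm_ge0//.
  by rewrite ler_weXn2l// ltnW// ltn_pmod.
exact: bounded_by_iter.
Qed.

Lemma op_null_stable S : op_null (fun n => iter n S) -> stable S.
Proof.
have h0 : 0 < 2^-1 :> R by rewrite invr_gt0.
by move=> /(_ _ h0)[N hN]; exists N.+1 => //; exact: hN.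
Qed.

(** With [F n] the n-th partial sum, shifting by [m] at least halves every
    term, so [F n <= F (m + n) <= F m + F n / 2], whence [F n <= 2 F m]. *)
Lemma stable_summable S x : stable S ->
  exists B, forall n, \sum_(0 <= k < n) rnorm (iter k S x) <= B.
Proof.
move=> [m m0 hm]; pose F n := \sum_(0 <= k < n) rnorm (iter k S x).
exists (2 * F m) => n; rewrite -/(F n).
have Fle : F n <= F (m + n)%N.
  rewrite /F -(subnKC (leq_addl m n)) /index_iota !subn0 iotaD big_cat/= lerDl.
  by apply: sumr_ge0 => k _; exact: rnorm_ge0.
have Fm : F (m + n)%N <= F m + 2^-1 * F n.
  rewrite {1}/F (big_cat_nat (leq0n m) (leq_addr n m))/= lerD2l.
  rewrite -{1}[m]add0n big_addn addKn mulr_sumr ler_sum// => k _.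
  by rewrite addnC iterD.
lra.
Qed.

(** The norm of [(1 - u f)^-1 - (1 - u g)^-1] is at most [eps] for every [u] on
    the unit circle.  Comparing the solutions [x] and [y] of the two equations
    with a common right-hand side expresses this without presupposing that the
    inverses exist, so no solvability has to be carried along. *)
Definition resolvents_close (eps : R) f (g : X -> X) :=
  forall u, normc u = 1 -> forall x y, x - u *: f x = y - u *: g y ->
    rnorm (x - y) <= eps * rnorm (x - u *: f x).

(** If [x - v^2 S^2 x = w] then [x + v S x] and [x - v S x] solve the equations
    for [v S] and [- v S] with the same [w], and [x] is their average.  The same
    holds for [T], and [v], [- v] both lie on the circle, so the bound [eps] is
    averaged with itself. *)
Lemma resolvents_close_sqr eps S T :
  resolvents_close eps S T -> resolvents_close eps (iter 2 S) (iter 2 T).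
Proof.
move=> h u u1 x y; pose v := sqrtc u.
have vv : v * v = u by rewrite -expr2 sqr_sqrtc.
have v1 : normc v = 1.
  have : normc v ^+ 2 == 1 by rewrite -normcX sqr_sqrtc u1.
  by rewrite sqrp_eq1 ?normc_ge0// => /eqP.
have Nv1 : normc (- v) = 1 by rewrite normcN.
have E w (S' : {linear X -> X}) z : w * w = u ->
    (z + w *: S' z) - w *: S' (z + w *: S' z) = z - u *: iter 2 S' z.
  move=> ww; rewrite [S' (_ + _)]linearD [S' (_ *: _)]linearZ/= scalerDr scalerA ww.
  by rewrite opprD addrA addrK.
have NN : (- v) * (- v) = u by rewrite mulrNN.
move=> xy; rewrite -(E _ _ _ vv) -(E _ _ _ vv) in xy.
have hp := h v v1 _ _ xy.
rewrite (E _ _ _ vv) in hp; rewrite !(E _ _ _ vv) -!(E _ _ _ NN) in xy.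
have hm := h _ Nv1 _ _ xy; rewrite (E _ _ _ NN) in hm.
set p := x + v *: S x - _ in hp; set q := x + - v *: S x - _ in hm.
have pq : x - y = 2^-1 *: (p + q).
  rewrite /p /q !scaleNr !opprD !opprK addrACA.
  rewrite [x + v *: S x + _]addrACA subrr addr0.
  rewrite [- y - _ + _]addrACA addNr addr0 -!mulr2n mulNrn -mulrnBl.
  by rewrite -[(x - y) *+ 2]scaler_nat scalerA mulVf ?scale1r// pnatr_eq0.
rewrite pq rnormZ normcV normc_nat ler_pdivrMl// (le_trans (rnormD _ _))//.
lra.
Qed.

Lemma resolvents_close_iter eps S T m : resolvents_close eps S T ->
  resolvents_close eps (iter (2 ^ m) S) (iter (2 ^ m) T).
Proof.
move=> h; elim: m => [|m IH]; first exact: h.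
have E (S' : {linear X -> X}) : iter (2 ^ m.+1) S' = iter 2 (iter (2 ^ m) S').
  by apply/funext => x; rewrite expnS iterM.
by rewrite !E; exact: resolvents_close_sqr.
Qed.

(** For large [m] the operator [A = S^(2^m)] has norm at most 1/7, so that
    [(1 - A)^-1] is within 1/6 of the identity; hence [(1 - B)^-1], with
    [B = T^(2^m)], is within 1/3 of it, and [B] has norm at most 1/2. *)
Lemma resolvents_close_stable S T b : 0 <= b -> bounded_by b S ->
  resolvents_close 6^-1 S T -> stable S -> stable T.
Proof.
move=> b0 hb close /(stable_op_null b0 hb).
have h7 : 0 < 7^-1 :> R by rewrite invr_gt0.
move=> /(_ _ h7)[m hm]; exists (2 ^ m)%N; first by rewrite expn_gt0.
have {}hm : bounded_by 7^-1 (iter (2 ^ m) S) by apply: hm; rewrite ltnW// ltn_expl.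
move=> y; set B := iter _ T; set A := iter (2 ^ m) S in hm.
have [|_ sol] := @contraction_regular _ _ (iter (2 ^ m) S) 7^-1 (ltW h7) _ hm.
  by rewrite invf_lt1// ltr1n.
have [a ha] := sol (y - B y); rewrite -/A in ha.
have n1 : normc (1 : R[i]) = 1 by rewrite normc1.
have := @resolvents_close_iter _ _ _ m close 1 n1 a y; rewrite -/A -/B.
rewrite !scale1r ha => /(_ erefl) ay.
have Aa : rnorm (A a) <= 7^-1 * rnorm a := hm a.
have h1 : rnorm a <= rnorm (y - B y) + rnorm (A a).
  by rewrite -{1}(subrK (A a) a) ha rnormD.
have h2 : rnorm (B y) <= rnorm (a - y) + rnorm (A a).
  rewrite rnormBC (_ : B y = (y - a) + A a) ?rnormD//.
  by rewrite -{1}(subKr y (B y)) -ha opprB addrCA addrC.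
have h3 := rnormB y (B y).
lra.
Qed.

(** Resolvent identity:
    [(1 - u r T)^-1 - (1 - u s T)^-1 = u (r - s) (1 - u r T)^-1 T (1 - u s T)^-1],
    whose norm is at most [(s - r) M^2 b]; the assumption makes this 1/6. *)
Lemma stable_step T b M r s : 0 <= b -> bounded_by b T -> 0 <= M ->
  (forall l, normc l <= 1 -> bounded_below M (l \*: T)) ->
  0 <= r -> r <= s -> s <= 1 -> 6 * (M * M * b * (s - r)) <= 1 ->
  stable (r%:C \*: T) -> stable (s%:C \*: T).
Proof.
move=> b0 hb M0 hM r0 rs s1 hd; have s0 := le_trans r0 rs.
apply: (@resolvents_close_stable _ _ (normc r%:C * b)).
- by rewrite mulr_ge0// normc_ge0.
- exact: bounded_by_scale.
move=> u u1 x y /=; rewrite !scalerA => xy; set z := x - _ *: _.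
have hy : rnorm y <= M * rnorm z.
  rewrite /z xy; apply: (hM (u * s%:C)).
  by rewrite normcM u1 mul1r normc_real ger0_norm.
have := hM (u * r%:C) _ (x - y) => /=.
rewrite normcM u1 mul1r normc_real ger0_norm// (le_trans rs s1) => /(_ isT).
have -> : x - y - (u * r%:C) *: T (x - y) = - ((u * (s - r)%:C) *: T y).
  rewrite linearB scalerBr opprD addrACA -opprD xy opprD addrACA subrr add0r.
  by rewrite opprK addrC -opprB -scalerBl -mulrBr rmorphB.
rewrite rnormN rnormZ normcM u1 mul1r normc_real ger0_norm ?subr_ge0//.
move/le_trans; apply.
have h1 := hb y; have z0 := rnorm_ge0 z; have sr0 : 0 <= s - r by rewrite subr_ge0.
have h2 : rnorm (T y) <= b * (M * rnorm z) by rewrite (le_trans h1)// ler_wpM2l.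
have h3 : M * ((s - r) * rnorm (T y)) <= M * ((s - r) * (b * (M * rnorm z))).
  by do 2! rewrite ler_wpM2l//.
rewrite (le_trans h3)//.
rewrite [leLHS](_ : _ = (M * M * b * (s - r)) * rnorm z); last by ring.
by rewrite ler_wpM2r// -[leRHS]mul1r ler_pdivlMr// mulrC.
Qed.

(** The admissible length of a step depends only on [M] and [b], so the points
    [k / K] for a large [K] lead from [0] to [T] in finitely many steps. *)
Lemma stable_of_bounded_below T b M : 0 <= b -> bounded_by b T -> 0 <= M ->
  (forall l, normc l <= 1 -> bounded_below M (l \*: T)) -> stable T.
Proof.
move=> b0 hb M0 hM; pose K := (Num.truncn (6 * (M * M * b))).+1.
have Kgt : 6 * (M * M * b) < K%:R by rewrite truncnS_gt.
have K0 : 0 < K%:R :> R by rewrite ltr0n.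
have H k : (k <= K)%N -> stable ((k%:R / K%:R : R)%:C \*: T).
  elim: k => [_|k IH kK].
    exists 1%N => // x; rewrite /= mul0r rmorph0 scale0r rnorm0.
    rewrite mulr_ge0 ?invr_ge0//.
    exact: rnorm_ge0.
  apply: (stable_step b0 hb M0 hM _ _ _ _ (IH (ltnW kK))).
  - by rewrite divr_ge0.
  - by rewrite ler_pM2r ?invr_gt0// ler_nat.
  - by rewrite ler_pdivrMr// mul1r ler_nat.
  - rewrite -mulrBl -natrB// subSnn mul1r mulrA ler_pdivrMr// mul1r.
    exact: ltW.
have := H K (leqnn K); rewrite divff ?gt_eqF// rmorph1.
have -> // : (1 \*: T : X -> X) = T by apply/funext => x /=; rewrite scale1r.
Qed.

Lemma bounded_below_perturb T b c (l m : R[i]) :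
  0 <= b -> bounded_by b T -> 0 <= c ->
  bounded_below c (l \*: T) -> c * b * normc (m - l) <= 2^-1 ->
  bounded_below (2 * c) (m \*: T).
Proof.
move=> b0 hb c0 hc hd x /=; have := hc x; rewrite /=.
have -> : x - l *: T x = (x - m *: T x) + (m - l) *: T x.
  by rewrite scalerBl addrA subrK.
have := rnormD (x - m *: T x) ((m - l) *: T x); rewrite rnormZ.
set A := rnorm (_ + _); set B := rnorm (_ - _) => h1 h2.
have h3 : normc (m - l) * rnorm (T x) <= normc (m - l) * (b * rnorm x).
  by rewrite ler_wpM2l// normc_ge0.
have h4 : c * A <= c * (B + normc (m - l) * (b * rnorm x)).
  by rewrite ler_wpM2l// (le_trans h1)// lerD2l.
have h5 : c * b * normc (m - l) * rnorm x <= 2^-1 * rnorm x.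
  by rewrite ler_wpM2r// rnorm_ge0.
lra.
Qed.

Lemma normc_le (x y : R) : normc (x +i* y) <= `|x| + `|y|.
Proof.
have -> : x +i* y = x%:C + (0 +i* y) by simpc.
rewrite (le_trans (le_normcD _ _))// normc_real lerD2l.
by rewrite /normc expr0n add0r sqrtr_sqr.
Qed.

Lemma compact_disk : compact [set p : R * R | p.1 * p.1 + p.2 * p.2 <= 1].
Proof.
apply: (@subclosed_compact _ _ (`[(-1 : R), 1] `*` `[(-1 : R), 1])%classic).
- apply: (@closed_comp _ _ (fun p : R * R => p.1 * p.1 + p.2 * p.2)
    [set x | x <= 1]).
    move=> p _; apply: cvgD; apply: cvgM; (exact: cvg_fst || exact: cvg_snd).
  exact: closed_le.
- by apply: compact_setX; exact: segment_compact.
- move=> [x y] /= h; split; rewrite /= in_itv/=; nra.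
Qed.

(** A lower bound at [l] persists, up to a factor 2, in a neighbourhood of [l];
    compactness of the closed disk makes the constant uniform. *)
Lemma uniform_bounded_below T b : 0 <= b -> bounded_by b T ->
  (forall l, normc l <= 1 -> exists2 c : R, 0 <= c & bounded_below c (l \*: T)) ->
  exists2 M : R, 0 <= M & forall l, normc l <= 1 -> bounded_below M (l \*: T).
Proof.
move=> b0 hb hl.
have diskE (x y : R) : (normc (x +i* y) <= 1) = (x * x + y * y <= 1).
  by rewrite /normc -[X in _ <= X]sqrtr1 ler_sqrt// !expr2.
pose P n (p : R * R) := bounded_below (n%:R : R) ((p.1 +i* p.2) \*: T).
have : \forall n \near \oo, [set p : R * R | p.1 * p.1 + p.2 * p.2 <= 1] `<=` P n.
  apply: ((compact_near_coveringP _).1 compact_disk) => -[x y] /= xy.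
  have [|c c0 hc] := hl (x +i* y); first by rewrite diskE.
  (* each coordinate moves by less than d, so the point moves by at most 2 d,
     and 2 d c b <= 1/2 *)
  pose d : R := (4 * (c * b + 1))^-1.
  have cb0 : 0 <= c * b by exact: mulr_ge0.
  have d0 : 0 < d by rewrite invr_gt0; lra.
  pose N := (Num.truncn (2 * c)).+1.
  exists (ball (x, y) d, [set n | (N <= n)%N]).
    by split; [exact: nbhsx_ballx | exists N].
  move=> [[x' y'] n] /= [[/= hx hy] Nn] v.
  have : bounded_below (2 * c) ((x' +i* y') \*: T).
    apply: bounded_below_perturb b0 hb c0 hc _.
    have -> : (x' +i* y') - (x +i* y) = (x' - x) +i* (y' - y) by simpc.
    have h1 : normc ((x' - x) +i* (y' - y)) <= 2 * d.
      rewrite (le_trans (normc_le _ _))//.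
      move: hx hy; rewrite /ball/= (distrC x) (distrC y) => hx hy; lra.
    rewrite (le_trans (ler_wpM2l cb0 h1))//.
    have dE : d * (c * b + 1) = 4^-1.
      by rewrite /d invfM -mulrA mulVf ?mulr1// gt_eqF//; lra.
    lra.
  move=> h; rewrite (le_trans (h v))// ler_wpM2r ?rnorm_ge0//.
  rewrite (le_trans (ltW (truncnS_gt _)))// ler_nat//.
move=> [N _ /(_ N (leqnn N)) hN]; exists N%:R => // -[x y] l1.
by apply: (hN (x, y)); rewrite /= -diskE.
Qed.

End PowersToZero.

(** * Uniform boundedness and the logarithmic series *)

Section UniformBoundedness.
Variables (R : realType) (X : completeNormedModType R[i]).
Implicit Types (S T : {linear X -> X}) (f : X -> X)
  (b c q r s eps K M : R).

(** Any ball of radius [d] contains a point with large image: for [w] of norm at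
    most [d] with [S w] nearly maximal, the images of [x + w] and [x - w] differ
    by [2 S w], so one of them is at least as large as [S w]. *)
Lemma far_image S b (d : R) (x : X) : 0 <= b -> bounded_by b S -> 0 < d ->
  0 < opnorm S ->
  exists y, rnorm (y - x) <= d /\ 2 / 3 * opnorm S * d <= rnorm (S y).
Proof.
move=> b0 hb d0 S0.
have [_ [w /= w1 <-] hw] :
  exists2 e, [set rnorm (S x) | x in [set x : X | `|x| <= 1]] e
    & 2 / 3 * opnorm S < e.
  apply: sup_gt; last by rewrite -/(opnorm S); lra.
  by exists (rnorm (S 0)), 0 => //=; rewrite normr0.
rewrite ball_rnorm in w1.
have dw : rnorm (d%:C *: w) <= d.
  by rewrite rnormZ normc_real gtr0_norm// ler_piMr// ltW.
have Sdw : 2 / 3 * opnorm S * d <= rnorm (S (d%:C *: w)).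
  by rewrite linearZ rnormZ normc_real gtr0_norm// mulrC ler_wpM2l// ltW.
have h : S (x + d%:C *: w) - S (x - d%:C *: w) = 2%:R *: S (d%:C *: w).
  by rewrite linearD linearB opprD opprK addrACA subrr add0r scaler_nat mulr2n.
have := rnormB (S (x + d%:C *: w)) (S (x - d%:C *: w)).
rewrite h rnormZ normc_nat => hn.
have [hl|hl] := leP (2 / 3 * opnorm S * d) (rnorm (S (x + d%:C *: w))).
  by exists (x + d%:C *: w); rewrite addrC addKr.
exists (x - d%:C *: w); rewrite addrC addKr rnormN; split => //.
lra.
Qed.

(** Gliding hump.  If the norms are unbounded, select operators with norms
    [g k >= 6 3^k (k + 1)] and move from [x k] to a point [x (k+1)] at distance at
    most [3^-k] whose image has norm at least [(2/3) g k 3^-k].  The limit [l] is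
    within [3^-k / 2] of [x (k+1)], so the k-th image of [l] has norm at least
    [(2/3 - 1/2) g k 3^-k >= k + 1], against pointwise boundedness. *)
Lemma uniform_boundedness (H : nat -> {linear X -> X}) :
  (forall n, exists2 b : R, 0 <= b & bounded_by b (H n)) ->
  (forall x, exists M : R, forall n, rnorm (H n x) <= M) ->
  exists2 C : R, 0 <= C & forall n, bounded_by C (H n).
Proof.
move=> Hb Hpt; apply: contrapT => nC.
have HZ n a x : H n (a *: x) = a *: H n x by rewrite linearZ.
have bound n : bounded_by (opnorm (H n)) (H n).
  by have [b b0 hb] := Hb n; exact: opnorm_bound b0 hb (HZ n).
have large (k : nat) : exists n, 6 * 3 ^+ k * k.+1%:R < opnorm (H n).
  apply: contrapT => /forallNP h; apply: nC; exists (6 * 3 ^+ k * k.+1%:R).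
    by rewrite !mulr_ge0 ?exprn_ge0.
  move=> n; apply: bounded_by_le (bound n).
  by rewrite leNgt; apply/negP; exact: h.
have [s hs] := choice large; pose g k := opnorm (H (s k)).
have gpos k : 0 < g k.
  by apply: le_lt_trans (hs k); rewrite !mulr_ge0 ?exprn_ge0.
have step (kx : nat * X) : exists y, rnorm (y - kx.2) <= 3^-1 ^+ kx.1 /\
    2 / 3 * g kx.1 * 3^-1 ^+ kx.1 <= rnorm (H (s kx.1) y).
  have [b b0 hb] := Hb (s kx.1).
  by apply: far_image b0 hb _ (gpos _); rewrite exprn_gt0// invr_gt0.
have [F hF] := choice step.
pose x := fix x n := if n is k.+1 then F (k, x k) else 0.
have h0 : 0 <= 3^-1 :> R by rewrite invr_ge0.
have h1 : 3^-1 < 1 :> R by rewrite invf_lt1// ltr1n.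
have xq n : rnorm (x n.+1 - x n) <= 1 * 3^-1 ^+ n.
  by rewrite mul1r; case: (hF (n, x n)).
have [l hl] := geometric_limit ler01 h0 h1 xq.
have [M hM] := Hpt l; pose k := Num.truncn M.
have Mk : M < k.+1%:R by exact: truncnS_gt.
have [_ /= far] := hF (k, x k); rewrite -/(x k.+1) in far.
have close := hl k.+1; rewrite mul1r exprS in close.
have p3 : 3^-1 ^+ k * 3 ^+ k = 1 :> R by rewrite -exprMn mulVf// expr1n.
have := hs k; rewrite -/(g k) => gk.
have q0 : 0 < 3^-1 ^+ k :> R by rewrite exprn_gt0// invr_gt0.
set q := 3^-1 ^+ k in far close p3 q0.
have gq : 6 * k.+1%:R < g k * q.
  have e : 6 * 3 ^+ k * k.+1%:R * q = 6 * k.+1%:R * (q * 3 ^+ k) by ring.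
  by rewrite -[ltLHS]mulr1 -[X in _ * X < _]p3 -e ltr_pM2r.
have close' : rnorm (l - x k.+1) <= 2^-1 * q.
  have e : 1 - 3^-1 = 2 / 3 :> R by lra.
  by move: close; rewrite e invf_div; lra.
have h2 : rnorm (H (s k) (l - x k.+1)) <= g k * (2^-1 * q).
  by rewrite (le_trans (bound (s k) _))// ler_wpM2l// (ltW (gpos k)).
have h3 : rnorm (H (s k) (x k.+1)) <=
    rnorm (H (s k) l) + rnorm (H (s k) (l - x k.+1)).
  have := rnormB (H (s k) l) (H (s k) (l - x k.+1)).
  by rewrite -[X in rnorm X <= _]linearB subKr.
have h4 := hM (s k).
lra.
Qed.

Lemma harmonic_unbounded (C : R) : exists N, C <= \sum_(0 <= n < N) n.+1%:R^-1.
Proof.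
apply: contrapT => /forallNP h; apply: (@dvg_harmonic R).
apply: nondecreasing_is_cvgn.
  by apply: nondecreasing_series => n _ _; exact: harmonic_ge0.
exists C => _ [n _ <-]; rewrite leNgt; apply/negP => /ltW; exact: h.
Qed.

(** With [h N x] the N-th partial sum and [a] the N-th harmonic number,
    [a x = h N x + sum (x - S^n x) / n].  The partial sums are uniformly bounded
    by some [C], and the last sum is a polynomial in [S] applied to [x - S x], of
    norm at most [L]; choosing [N] with [a >= C + 1] leaves
    [rnorm x <= L * rnorm (x - S x)]. *)
Lemma log_series_bounded_below S b : 0 <= b -> bounded_by b S ->
  (forall x, exists M : R, forall N,
    rnorm (\sum_(0 <= n < N) n.+1%:R^-1 *: iter n.+1 S x) <= M) ->
  exists2 c : R, 0 <= c & bounded_below c S.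
Proof.
move=> b0 hb hpt.
pose h N x := \sum_(0 <= n < N) n.+1%:R^-1 *: iter n.+1 S x.
have hlin N : linear (h N).
  move=> a x y; rewrite /h scaler_sumr -big_split/=; apply: eq_bigr => n _.
  by rewrite -!iterS linearP scalerDr !scalerA mulrC.
pose H N : {linear X -> X} := HB.pack (h N)
  (GRing.isLinear.Build _ _ _ _ _ (hlin N)).
have [|C C0 hC] := @uniform_boundedness H _ hpt.
  move=> N; exists (\sum_(0 <= n < N) n.+1%:R^-1 * b ^+ n.+1).
    by apply: sumr_ge0 => n _; rewrite mulr_ge0 ?invr_ge0// exprn_ge0.
  move=> x; rewrite (le_trans (rnorm_sum _ _ _))// mulr_suml ler_sum// => n _.
  rewrite rnormZ normcV normc_nat -mulrA ler_wpM2l ?invr_ge0//.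
  exact: bounded_by_iter.
have [N hN] := harmonic_unbounded (C + 1).
pose L := \sum_(0 <= n < N) n.+1%:R^-1 * \sum_(0 <= k < n.+1) b ^+ k.
exists L => [|x].
  apply: sumr_ge0 => n _; rewrite mulr_ge0 ?invr_ge0// sumr_ge0// => k _.
  exact: exprn_ge0.
have e : (\sum_(0 <= n < N) n.+1%:R^-1) *: x =
    h N x + \sum_(0 <= n < N) n.+1%:R^-1 *: (x - iter n.+1 S x) :> X.
  rewrite scaler_suml -big_split/=; apply: eq_bigr => n _.
  by rewrite -scalerDr addrC subrK.
have h1 : rnorm (\sum_(0 <= n < N) (n.+1%:R^-1 : R[i]) *: (x - iter n.+1 S x)) <=
    L * rnorm (x - S x).
  rewrite (le_trans (rnorm_sum _ _ _))// mulr_suml ler_sum// => n _.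
  rewrite rnormZ normcV normc_nat -mulrA ler_wpM2l ?invr_ge0//.
  rewrite -telescope_iter (le_trans (rnorm_sum _ _ _))// mulr_suml ler_sum// => k _.
  by rewrite -linearB; exact: bounded_by_iter.
have h2 : rnorm (h N x) <= C * rnorm x := hC N x.
have := rnormD (h N x) (\sum_(0 <= n < N) n.+1%:R^-1 *: (x - iter n.+1 S x)).
rewrite -e rnormZ.
have -> : \sum_(0 <= n < N) n.+1%:R^-1 =
    (\sum_(0 <= n < N) n.+1%:R^-1 : R)%:C :> R[i].
  by rewrite rmorph_sum; apply: eq_bigr => n _; rewrite fmorphV/= rmorph_nat.
rewrite normc_real ger0_norm; last by apply: sumr_ge0 => n _; rewrite invr_ge0.
have h3 : (C + 1) * rnorm x <= (\sum_(0 <= n < N) n.+1%:R^-1) * rnorm x.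
  by rewrite ler_wpM2r// rnorm_ge0.
lra.
Qed.

End UniformBoundedness.

(** * Cesaro means *)

Section Ergodic.
Variables (R : realType) (X : completeNormedModType R[i]).
Implicit Types (S T P : {linear X -> X}) (b p : R).

Lemma cesaro_bounded S b n : 0 <= b -> bounded_by b S ->
  exists2 K : R, 0 <= K & bounded_by K (Defs.cesaro S n).
Proof.
move=> b0 hb; exists (n%:R^-1 * \sum_(1 <= k < n.+1) b ^+ k).
  by rewrite mulr_ge0 ?invr_ge0// sumr_ge0// => k _; rewrite exprn_ge0.
move=> x; rewrite /Defs.cesaro rnormZ normcV normc_nat -mulrA ler_wpM2l ?invr_ge0//.
rewrite (le_trans (rnorm_sum _ _ _))// mulr_suml ler_sum// => k _.
exact: bounded_by_iter.
Qed.

Lemma uniformly_ergodicP S P b p :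
  0 <= b -> bounded_by b S -> 0 <= p -> bounded_by p P ->
  (opnorm (fun x => Defs.cesaro S n x - P x) @[n --> \oo] --> (0 : R)) <->
  op_null (fun n x => Defs.cesaro S n x - P x).
Proof.
move=> b0 hb p0 hp; apply: op_nullP => n.
  have [K K0 hK] := cesaro_bounded n b0 hb.
  exists (K + p) => [|x]; first exact: addr_ge0.
  by rewrite (le_trans (rnormB _ _))// mulrDl lerD.
move=> a x; rewrite linearZ/= scalerBr; congr (_ - _); rewrite /Defs.cesaro.
rewrite scalerA mulrC -scalerA; congr (_ *: _); rewrite scaler_sumr.
by apply: eq_bigr => k _; rewrite linearZ.
Qed.

(** Writing [x = y - S y] with [y] bounded in terms of [x], the n-th mean of [x]
    is [(S y - S^(n+1) y) / n]; the limit projection is therefore 0. *)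
Lemma regular_uniformly_ergodic S b : 0 <= b -> bounded_by b S ->
  (forall e : R, 0 < e -> exists N, forall n, (N <= n)%N ->
     bounded_by (e * n%:R) (iter n S)) ->
  regular S -> uniformly_ergodic S.
Proof.
move=> b0 hb hS [[c c0 hc] hs]; exists (\0 : {linear X -> X}).
have h00 : bounded_by 0 (\0 : {linear X -> X}).
  by move=> x; rewrite /= rnorm0 mul0r.
split; first exact: bounded_continuous h00.
apply/(uniformly_ergodicP b0 hb (lexx 0) h00) => e e0 /=.
pose D := b * c + 1; have D0 : 0 < D by rewrite ltr_wpDl// mulr_ge0.
pose e' := e / (2 * D); have e'0 : 0 < e' by rewrite divr_gt0// mulr_gt0.
have eE : e' * D = e / 2.
  by rewrite /e' invfM mulrA -mulrA mulVf ?mulr1// gt_eqF.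
have [N hN] := hS e' e'0.
pose N' := maxn N (Num.truncn e'^-1).+1; exists N' => n Nn x.
have n_N : (N <= n)%N by rewrite (leq_trans _ Nn)// leq_maxl.
have n0 : (0 < n)%N by rewrite (leq_trans _ Nn)// (leq_trans _ (leq_maxr _ _)).
have n0R : 0 < n%:R :> R by rewrite ltr0n.
have n_e : 1 <= e' * n%:R.
  rewrite mulrC -ler_pdivrMr// mul1r (le_trans (ltW (truncnS_gt _)))// ler_nat.
  by rewrite (leq_trans _ Nn)// leq_maxr.
have [y hy] := hs x; rewrite /= subr0 /Defs.cesaro.
rewrite rnormZ normcV normc_nat ler_pdivrMl//.
have -> : \sum_(1 <= k < n.+1) iter k S x = S y - iter n S (S y).
  rewrite -telescope_iter big_add1 /=; apply: eq_bigr => k _.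
  by rewrite -iterS iterSr -hy !linearB.
have hyx : rnorm (S y) <= b * (c * rnorm x).
  by rewrite (le_trans (hb y))// ler_wpM2l// -hy hc.
rewrite (le_trans (rnormB _ _))//.
have h2 : rnorm (iter n S (S y)) <= e' * n%:R * rnorm (S y) by exact: hN.
have h3 : rnorm (S y) <= e' * n%:R * rnorm (S y).
  by rewrite ler_peMl// rnorm_ge0.
have h4 : e' * n%:R * rnorm (S y) <= e' * n%:R * (b * (c * rnorm x)).
  by rewrite ler_wpM2l// ltW// mulr_gt0.
have h5 : e' * n%:R * (b * (c * rnorm x)) <= n%:R * rnorm x * (e' * D).
  rewrite /D; have := rnorm_ge0 x => x0.
  have : 0 <= e' * n%:R * rnorm x by rewrite mulr_ge0// ltW// mulr_gt0.
  lra.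
rewrite eE in h5.
lra.
Qed.

(** The Cesaro means are eventually bounded, and the n-th power is
    [n A_n - (n-1) A_(n-1)]. *)
Lemma uniformly_ergodic_growth S b : 0 <= b -> bounded_by b S ->
  uniformly_ergodic S ->
  exists2 K : R, 0 <= K &
    exists n0, forall n, (n0 <= n)%N -> bounded_by (K * n%:R) (iter n S).
Proof.
move=> b0 hb [P [cP +]]; have [p p0 hp] := continuous_bounded cP.
move/(uniformly_ergodicP b0 hb p0 hp) => /(_ 1 ltr01)[N hN].
have hA n : (N <= n)%N -> bounded_by (1 + p) (Defs.cesaro S n).
  move=> Nn x; rewrite -[Defs.cesaro S n x](subrK (P x)) mulrDl.
  by rewrite (le_trans (rnormD _ _))// lerD// hN.
have sumE n x : (0 < n)%N ->
    \sum_(1 <= k < n.+1) iter k S x = n%:R *: Defs.cesaro S n x.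
  move=> n0; rewrite /Defs.cesaro scalerA divff ?scale1r// pnatr_eq0 -lt0n//.
exists (2 * (1 + p)); first by rewrite mulr_ge0// addr_ge0.
exists N.+2 => -[//|n] Nn x.
have -> : iter n.+1 S x =
    n.+1%:R *: Defs.cesaro S n.+1 x - n%:R *: Defs.cesaro S n x.
  have n0 : (0 < n)%N by rewrite -ltnS (leq_trans _ Nn).
  by rewrite -!sumE// [X in X - _]big_nat_recr//= addrAC subrr add0r.
rewrite (le_trans (rnormB _ _))//.
rewrite [rnorm (n.+1%:R *: _)]rnormZ [rnorm (n%:R *: _)]rnormZ !normc_nat.
have h1 : n.+1%:R * rnorm (Defs.cesaro S n.+1 x) <= n.+1%:R * ((1 + p) * rnorm x).
  by rewrite ler_wpM2l// hA// ltnW// ltnW.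
have h2 : n%:R * rnorm (Defs.cesaro S n x) <= n%:R * ((1 + p) * rnorm x).
  by rewrite ler_wpM2l// hA// -ltnS ltnW.
have h3 : n%:R * ((1 + p) * rnorm x) <= n.+1%:R * ((1 + p) * rnorm x).
  by rewrite ler_wpM2r ?ler_nat// mulr_ge0 ?rnorm_ge0// addr_ge0.
rewrite (le_trans (lerD h1 (le_trans h2 h3)))//.
by rewrite [leRHS](_ : _ =
  n.+1%:R * ((1 + p) * rnorm x) + n.+1%:R * ((1 + p) * rnorm x))//; ring.
Qed.

End Ergodic.

(** * Spectral conditions and the equivalence *)

Section Implications.
Variables (R : realType) (X : completeNormedModType R[i]).
Implicit Types (S T : {linear X -> X}) (b K : R) (z : R[i]).

Lemma unit_circleE (z : R[i]) : unit_circle z <-> normc z = 1.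
Proof.
split=> [z1|z1]; first exact: (congr1 (@complex.Re R) z1).
exact: (congr1 (real_complex R) z1).
Qed.

Lemma spectrum_circleP T : spectrum T `&` @unit_circle R = set0 <->
  forall z, normc z = 1 -> ~ spectrum T z.
Proof.
split=> [h z z1 Tz|h]; last first.
  by apply/seteqP; split => // z [Tz /unit_circleE/h].
have : (spectrum T `&` @unit_circle R) z by split => //; apply/unit_circleE.
by rewrite h.
Qed.

Lemma normc_neq0 (z : R[i]) : 0 < normc z -> z != 0.
Proof. by apply: contraTneq => ->; rewrite normc0 ltxx. Qed.

Lemma spectrum_bounded T b z :
  0 <= b -> bounded_by b T -> spectrum T z -> normc z <= b.
Proof.
move=> b0 hb; rewrite leNgt; apply/contraPN => bz.
have z0 : 0 < normc z by exact: le_lt_trans bz.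
apply: regular_notin_spectrum; first exact: normc_neq0.
have q0 : 0 <= normc z^-1 * b by rewrite mulr_ge0// normc_ge0.
have q1 : normc z^-1 * b < 1 by rewrite normcV mulrC ltr_pdivrMr// mul1r.
have [hbel hsol] :=
  @contraction_regular _ _ (z^-1 \*: T) _ q0 q1 (bounded_by_scale z^-1 hb).
by split=> //; exists (1 - normc z^-1 * b)^-1 => //; rewrite invr_ge0 subr_ge0 ltW.
Qed.

Lemma spectral_radius_ge T b z : 0 <= b -> bounded_by b T ->
  spectrum T z -> normc z <= spectral_radius T.
Proof.
move=> b0 hb Tz; apply: ub_le_sup; last by exists z.
by exists b => _ [w Tw <-]; exact: spectrum_bounded hb Tw.
Qed.

Lemma spectral_radius_le T (r : R) : 0 <= r ->
  (forall z, spectrum T z -> normc z <= r) -> spectral_radius T <= r.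
Proof.
move=> r0 h; have [n0|] := pselect ([set complex.Re `|z| | z in spectrum T] !=set0).
  by apply: ge_sup => // _ [z /h Tz <-].
by move=> /set0P/negP/negPn/eqP e; rewrite /spectral_radius e sup0.
Qed.

Lemma growth_spectral_radius_le1 T b K n0 : 0 <= b -> bounded_by b T -> 0 <= K ->
  (forall n, (n0 <= n)%N -> bounded_by (K * n%:R) (iter n T)) ->
  spectral_radius T <= 1.
Proof.
move=> b0 hb K0 hK; apply: spectral_radius_le => // z; rewrite leNgt.
apply/contraPN => z1; have z0 : 0 < normc z by exact: lt_trans z1.
apply: regular_notin_spectrum; first exact: normc_neq0.
by apply: growth_regular b0 hb K0 hK _; rewrite normcV invf_lt1.
Qed.

(** Outside the closed disk there is no spectrum by the bound on the spectral
    radius, and on the circle by assumption; inverting, [1 - l T] is bounded below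
    for every [l] in the closed disk. *)
Lemma spectrum_disk_stable T b :
  0 <= b -> bounded_by b T -> spectral_radius T <= 1 ->
  (forall z, normc z = 1 -> ~ spectrum T z) -> stable T.
Proof.
move=> b0 hb r1 hT.
have hbel l : normc l <= 1 -> exists2 c : R, 0 <= c & bounded_below c (l \*: T).
  move=> l1; have [->|l0] := eqVneq l 0.
    by exists 1 => // x; rewrite /= scale0r subr0 mul1r.
  have nl0 : 0 < normc l.
    by rewrite lt_neqAle normc_ge0 andbT eq_sym; apply: contra_neq l0 => /eq0_normc.
  rewrite -(invrK l); apply: notin_spectrum_bounded_below.
    by rewrite invr_eq0.
  have [e|l1'] := eqVneq (normc l) 1; first by apply: hT; rewrite normcV e invr1.
  move=> /(spectral_radius_ge b0 hb)/le_trans/(_ r1).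
  by rewrite normcV invf_le1// leNgt lt_neqAle l1' l1.
have [M M0 hM] := uniform_bounded_below b0 hb hbel.
exact: stable_of_bounded_below b0 hb M0 hM.
Qed.

(** Convergence of the series at each [x] bounds [1 - z T] below, and linear
    growth of the powers makes [1 - r z T] invertible for [r < 1]. *)
Lemma log_series_regular T b z : 0 <= b -> bounded_by b T ->
  (exists n0, forall n, (n0 <= n)%N -> bounded_by n%:R (iter n T)) ->
  (forall x, cvgn (fun N => \sum_(1 <= n < N.+1) (z ^+ n / n%:R) *: iter n T x)) ->
  normc z = 1 -> regular (z \*: T).
Proof.
move=> b0 hb [n0 hn0] hcv z1.
have hzb : bounded_by b (z \*: T).
  by rewrite -(mul1r b) -z1; exact: bounded_by_scale.
have [x|c c0 hc] := log_series_bounded_below b0 hzb.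
  have /cvg_seq_bounded[M [Mreal hM]] := hcv x.
  exists (`|complex.Re M| + 1) => N.
  have Mb : M < (`|complex.Re M| + 1)%:C.
    by rewrite -(RRe_real Mreal) ltcR (le_lt_trans (ler_norm _))// ltrDl.
  have := hM _ Mb N I; rewrite /= normE lecR; apply: le_trans.
  rewrite le_eqVlt; apply/orP; left; apply/eqP; congr rnorm.
  rewrite big_add1; apply: eq_bigr => n _.
  by rewrite [X in _ *: X = _](iter_scale n.+1 z T x) scalerA mulrC.
split; first by exists c.
apply: (boundary_solvable b0 hzb c0 hc) => r r0 r1.
have -> : r%:C \*: (z \*: T) = (r%:C * z) \*: T :> (X -> X).
  by apply/funext => x /=; rewrite scalerA.
suff [] : regular ((r%:C * z) \*: T) by [].
apply: (@growth_regular _ _ T b 1 n0 _ b0 hb ler01).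
  by move=> n /hn0; rewrite mul1r.
by rewrite normcM z1 mulr1 normc_real ger0_norm.
Qed.

Lemma stable_log_series_cvg T z x : stable T -> normc z = 1 ->
  cvgn (fun N => \sum_(1 <= n < N.+1) (z ^+ n / n%:R) *: iter n T x).
Proof.
move=> /stable_summable-/(_ (T x))[B hB] z1.
pose u n := (z ^+ n.+1 / n.+1%:R) *: iter n.+1 T x.
have -> : (fun N => \sum_(1 <= n < N.+1) (z ^+ n / n%:R) *: iter n T x) = series u.
  by apply/funext => N; rewrite big_add1.
apply: (@series_cvg_of_bounded_rnorm _ _ u B) => N; apply: le_trans (hB N).
apply: ler_sum => n _.
rewrite /u rnormZ normcM normcX z1 expr1n mul1r normcV normc_nat iterSr.
by rewrite ler_piMl ?rnorm_ge0// invf_le1// ler1n.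
Qed.

End Implications.

Theorem theorem4p3 (R : realType) (X : completeNormedModType R[i])
    (T : {linear X -> X}) (hT : continuous T) :
  [<-> uniformly_ergodic T /\ spectrum T `&` @unit_circle R = set0;
       spectral_radius T <= 1 /\ spectrum T `&` @unit_circle R = set0;
       opnorm (iter n T) @[n --> \oo] --> (0 : R);
       opnorm (iter n T) / n%:R @[n --> \oo] --> (0 : R) /\
         (forall (x : X) (z : R[i]), unit_circle z ->
            cvgn (fun N => \sum_(1 <= n < N.+1) (z ^+ n / n%:R) *: iter n T x));
       rotationally_uniformly_ergodic T /\
         spectrum T `&` @unit_circle R = set0].
Proof.
have [b b0 hb] := continuous_bounded hT.
have hbn n : exists2 c : R, 0 <= c & bounded_by c (iter n T).
  by exists (b ^+ n); [exact: exprn_ge0 | exact: bounded_by_iter].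
have nullP : (opnorm (iter n T) @[n --> \oo] --> (0 : R)) <->
    op_null (fun n => iter n T).
  by apply: op_nullP hbn _ => n a x; rewrite linearZ.
tfae.
- move=> [hE hS]; split => //.
  have [K K0 [n0 hK]] := uniformly_ergodic_growth b0 hb hE.
  exact: growth_spectral_radius_le1 b0 hb K0 hK.
- move=> [r1 /spectrum_circleP hS]; apply/nullP.
  by apply: (stable_op_null b0 hb); exact: (spectrum_disk_stable b0 hb r1 hS).
- move=> h; split; last first.
    move=> x z /unit_circleE z1; apply: stable_log_series_cvg z1.
    by apply: op_null_stable; apply/nullP.
  apply: (squeeze_cvgr _ (cvg_cst 0) h); apply: nearW => n.
  have [c c0 hc] := hbn n; have o0 := opnorm_ge0 c0 hc.
  rewrite divr_ge0//=; case: n {hc} o0 => [|n] o0; first by rewrite invr0 mulr0.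
  by rewrite ler_piMr// invf_le1// ler1n.
- move=> [hn hcv].
  have small e : 0 < e -> exists N, forall n, (N <= n)%N ->
      bounded_by (e * n%:R) (iter n T).
    move=> e0; have [N _ hN] := (cvgrPdist_le _ _).1 hn e e0.
    exists N.+1 => n Nn; have [c c0 hc] := hbn n.
    apply: bounded_by_le (opnorm_bound c0 hc _); last first.
      by move=> a x; rewrite linearZ.
    have := hN n (ltnW Nn); rewrite /= sub0r normrN => /(le_trans (ler_norm _)).
    by rewrite ler_pdivrMr// ltr0n (leq_trans _ Nn).
  have reg z : normc z = 1 -> regular (z \*: T).
    move=> z1; apply: (log_series_regular b0 hb _ _ z1).
      by have [n0 h0] := small 1 ltr01; exists n0 => n /h0; rewrite mul1r.
    by move=> x; apply: hcv; apply/unit_circleE.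
  split; last first.
    apply/spectrum_circleP => z z1; apply: regular_notin_spectrum.
      by apply: normc_neq0; rewrite z1.
    by apply: reg; rewrite normcV z1 invr1.
  move=> z /unit_circleE z1.
  apply: (@regular_uniformly_ergodic _ _ (z \*: T) b b0 _ _ (reg z z1)).
    by rewrite -(mul1r b) -z1; exact: bounded_by_scale.
  move=> e /small[N hN]; exists N => n /hN h x.
  rewrite iter_scale rnormZ normcX z1 expr1n mul1r.
  exact: h.
- move=> [hR hS]; split => //.
  have -> : (T : X -> X) = (fun x => 1 *: T x).
    by apply/funext => x; rewrite scale1r.
  by apply: hR; apply/unit_circleE; rewrite normc1.
Qed.
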